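(* Let $N(\cdot)$ be a unitarily invariant norm on $M_n(\mathbb{C})$, let $A\in M_n(\mathbb{C})$ be positive definite and let $X\in M_n(\mathbb{C})$. Then the function $h(t)=w_N(A^{t}XA^{t})$ is convex on $\mathbb{R}$.
   Context: For a norm $N$ on $M_n(\mathbb{C})$ (the $n\times n$ complex matrices), the generalized numerical radius of $Y\in M_n(\mathbb{C})$ is $w_N(Y)=\sup_{\theta\in\mathbb{R}}N(\mathrm{Re}(e^{i\theta}Y))$, where $\mathrm{Re}(Z)=\frac12(Z+Z^* )$. The norm $N$ is unitarily invariant if $N(UYV)=N(Y)$ for all $Y\in M_n(\mathbb{C})$ and all unitary $U,V\in M_n(\mathbb{C})$. For a positive definite (Hermitian) matrix $A$ and $t\in\mathbb{R}$, $A^t$ is defined by the functional calculus. *)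

(* Defs.v *)
From HB Require Import structures.
From mathcomp Require Import all_boot all_order all_algebra.
From mathcomp Require Import sesquilinear spectral.
From mathcomp Require Import complex.
From mathcomp Require Import all_classical all_reals all_analysis.

Set Implicit Arguments.
Unset Strict Implicit.
Unset Printing Implicit Defensive.

Import Order.TTheory GRing.Theory Num.Theory.

Local Open Scope classical_set_scope.
Local Open Scope ring_scope.
Local Open Scope complex_scope.
Local Open Scope sesquilinear_scope.

(* [`|c|] lives in [R[i]] (with zero imaginary part), hence the [complex.Re]. *)
Record is_mxnorm (R : realType) (n : nat) (N : 'M[R[i]]_n -> R) : Prop :=
  IsMxnorm {
    mxnorm_ge0 : forall Y, 0 <= N Y;
    mxnorm_eq0 : forall Y, N Y = 0 -> Y = 0;
    mxnormZ : forall (c : R[i]) Y, N (c *: Y) = complex.Re `|c| * N Y;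
    ler_mxnormD : forall Y Z, N (Y + Z) <= N Y + N Z }.

Definition unitarily_invariant (R : realType) (n : nat)
    (N : 'M[R[i]]_n -> R) : Prop :=
  forall U Y V : 'M[R[i]]_n,
    U \is unitarymx -> V \is unitarymx -> N (U *m Y *m V) = N Y.

(* On [R[i]], [0 < z] means that [z] is real and positive. *)
Definition posdefmx (R : realType) (n : nat) (A : 'M[R[i]]_n) : Prop :=
  A \is hermsymmx /\
  forall x : 'cV[R[i]]_n, x != 0 -> 0 < (x^t* *m A *m x) 0 0.

Definition mxRe (R : realType) (n : nat) (Z : 'M[R[i]]_n) : 'M[R[i]]_n :=
  2^-1 *: (Z + Z^t*).

Definition expi (R : realType) (theta : R) : R[i] := cos theta +i* sin theta.

Definition gen_numradius (R : realType) (n : nat) (N : 'M[R[i]]_n -> R)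
    (Y : 'M[R[i]]_n) : R :=
  sup [set N (mxRe (expi theta *: Y)) | theta in [set: R]].

(* Functional calculus of a Hermitian matrix: the library diagonalizes it as
   [A = invmx P *m diag_mx d *m P] with [P := spectralmx A] unitary and
   [d := spectral_diag A] real; [f] is applied to the eigenvalues. Meaningless
   when [A] is not Hermitian. *)
Definition mxfun (R : realType) (n : nat) (f : R -> R) (A : 'M[R[i]]_n) :
    'M[R[i]]_n :=
  invmx (spectralmx A) *m
  diag_mx (map_mx (fun z : R[i] => (f (complex.Re z))%:C) (spectral_diag A)) *m
  spectralmx A.

Definition mxpow (R : realType) (n : nat) (A : 'M[R[i]]_n) (t : R) :
    'M[R[i]]_n :=
  mxfun (fun x : R => x `^ t) A.

(* Main.v *)
Require Import Defs.
From HB Require Import structures.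
From mathcomp Require Import all_boot all_order all_algebra.
From mathcomp Require Import sesquilinear spectral.
From mathcomp Require Import complex.
From mathcomp Require Import all_classical all_reals all_analysis.
From mathcomp Require Import ring lra.

(** Since [A^t] is Hermitian, [Re (e^(i theta) A^t X A^t) = A^t Z A^t] with
    [Z = Re (e^(i theta) X)], and a supremum of convex functions is convex; so
    it is enough that [f t = N (Y t)] is convex, where [Y t = e^(tD) Z e^(tD)]
    and [D = log A] is taken diagonal. Let [L Y = D Y + Y D]; then
    [Y' = L Y].

    The maps [Y |-> e^(i s D) Y e^(i s D)] are isometries for [N] generated by
    [i L], whence [N Y <= N (Y + i c L Y)] for every real [c] (proved below with
    Cayley transforms in place of exponentials). Applying this to [c] and [-c]
    gives [N Y <= N (Y + c^2 L^2 Y)]. As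
    [Y (t + h) + Y (t - h) = 2 Y t + h^2 L^2 (Y t) + O(h^3)], the second
    differences of [f] are at least [- O(h^3)], and a maximum principle shows
    that a continuous function with this property is convex. *)

Set Implicit Arguments.
Unset Strict Implicit.
Unset Printing Implicit Defensive.

Import Order.TTheory GRing.Theory Num.Theory.
Import numFieldNormedType.Exports.

Local Open Scope classical_set_scope.
Local Open Scope ring_scope.
Local Open Scope complex_scope.
Local Open Scope sesquilinear_scope.

(** * Convexity from second differences *)

Section ConvexityCriterion.
Variable R : realType.
Implicit Types (f g : R -> R) (t h x y e : R).

(** [K] and [d] may depend on [t]: the maximum principle looks at one point only. *)
Definition second_diff_ge0 f := forall t, exists K, exists2 d, 0 < d &
  forall h, `|h| <= d -> 2 * f t <= f (t + h) + f (t - h) + K * `|h| ^+ 3.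

(* If [g] exceeded its chord, so would [g s - e s (1 - s)] for some small [e],
   and at an interior maximum the second difference of this function is at
   least [2 e h ^ 2 - O(h ^ 3)]. *)
Lemma below_chord_unit g : continuous g -> second_diff_ge0 g ->
  forall s : R, 0 <= s <= 1 -> g s <= s * g 1 + (1 - s) * g 0.
Proof.
move=> gc gK s /andP[s0 s1]; apply/ler_addgt0Pr => e e0.
pose phi x := g x - (x * g 1 + (1 - x) * g 0) - e * (x * (1 - x)).
have phic : continuous phi.
  move=> x; rewrite /phi; apply: cvgB; first apply: cvgB; first exact: gc.
  - by apply: cvgD; apply: cvgMl => //; apply: cvgB => //; exact: cvg_cst.
  - apply: cvgMr; apply: cvgM => //; apply: cvgB => //; exact: cvg_cst.
have [c] := EVT_max (@ler01 R) (continuous_subspaceT phic).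
rewrite in_itv /= => /andP[c0 c1] cmax.
have phi0 : phi 0 = 0 by rewrite /phi; ring.
have phi1 : phi 1 = 0 by rewrite /phi; ring.
suff phile0 : phi c <= 0.
  have := cmax s; rewrite in_itv /= s0 s1 => /(_ isT); rewrite /phi in phile0 *.
  nra.
have [->|cn0] := eqVneq c 0; first by rewrite phi0.
have [->|cn1] := eqVneq c 1; first by rewrite phi1.
have {cn0}c0 : 0 < c by rewrite lt_neqAle eq_sym cn0.
have {cn1}c1 : 0 < 1 - c by rewrite subr_gt0 lt_neqAle cn1.
exfalso.
have [K [d d0 gcK]] := gK c.
have K1 : 0 < `|K| + 1 by rewrite ltr_wpDl.
(* The bound by [e / (|K| + 1)] keeps the cubic error below [e h^2], against a gain of [2 e h^2];
   the last two keep [c + h] and [c - h] in the unit interval. *)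
pose h := Num.min (Num.min d (e / (`|K| + 1))) (Num.min c (1 - c)).
have h0 : 0 < h by rewrite !lt_min d0 c0 c1 divr_gt0.
have hd : h <= d by rewrite !ge_min lexx.
have he : h <= e / (`|K| + 1) by rewrite !ge_min lexx orbT.
have hc : h <= c by rewrite !ge_min lexx ?orbT.
have hc1 : h <= 1 - c by rewrite !ge_min lexx ?orbT.
have := gcK h; rewrite gtr0_norm // => /(_ hd) gch.
have /cmax phip : c + h \in `[0, 1]%R by rewrite in_itv /=; lra.
have /cmax phim : c - h \in `[0, 1]%R by rewrite in_itv /=; lra.
have Kh : K * h ^+ 3 <= e * h ^+ 2.
  rewrite exprS mulrA ler_wpM2r ?exprn_ge0 ?(ltW h0) //.
  rewrite ler_pdivlMr // in he.
  have := ler_norm K; nra.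
have : 0 < e * h ^+ 2 by rewrite mulr_gt0 // exprn_gt0.
rewrite /phi in phip phim; nra.
Qed.

Lemma second_diff_ge0_affine f a b : second_diff_ge0 f ->
  second_diff_ge0 (fun s => f (b + s * (a - b))).
Proof.
move=> fK t; have [K [d d0 fd]] := fK (b + t * (a - b)).
(* The increment becomes [h (a - b)]; the added 1 covers [a = b]. *)
exists (K * `|a - b| ^+ 3); exists (d / (`|a - b| + 1)).
  by rewrite divr_gt0 // ltr_wpDl.
move=> h; rewrite ler_pdivlMr ?ltr_wpDl // => hd.
have := fd (h * (a - b)); rewrite normrM exprMn => fh.
rewrite -mulrA [X in K * X]mulrC.
have -> : b + (t + h) * (a - b) = b + t * (a - b) + h * (a - b) by ring.
have -> : b + (t - h) * (a - b) = b + t * (a - b) - h * (a - b) by ring.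
apply: fh; apply: le_trans hd; rewrite ler_wpM2l // lerDl //.
Qed.

Lemma below_chord f : continuous f -> second_diff_ge0 f ->
  forall a b s : R, 0 <= s <= 1 ->
  f (s * a + (1 - s) * b) <= s * f a + (1 - s) * f b.
Proof.
move=> fc fK a b s s01.
have gc : continuous (fun s : R => f (b + s * (a - b))).
  move=> x; apply: continuous_comp; last exact: fc.
  by apply: cvgD; [exact: cvg_cst|apply: cvgMl].
have := below_chord_unit gc (second_diff_ge0_affine a b fK) s01.
rewrite mul0r mul1r addr0 subrKC.
by have -> : b + s * (a - b) = s * a + (1 - s) * b by ring.
Qed.

(** From [e^(-y) >= 1 - y] one gets [e^y <= 1 / (1 - y)], and
    [1 / (1 - y) - 1 - y = y^2 / (1 - y)]. *)
Lemma expR_sub1x_bound y : `|y| <= 2^-1 -> 0 <= expR y - 1 - y <= 2 * y ^+ 2.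
Proof.
rewrite ler_norml => /andP[ym yp].
have := expR_ge1Dx y; have := expR_ge1Dx (- y); have := expR_gt0 y.
have := expRxMexpNx_1 y; set a := expR y; set b := expR (- y) => ab a0 hb ha.
apply/andP; split; first lra.
have : a * (1 - y) <= 1 by rewrite -[leRHS]ab ler_wpM2l // ltW.
nra.
Qed.

(** With [y = x / 2] and [r = e^y - e^(-y) - 2 y], the left side is
    [|(r + 2 y)^2 - (2 y)^2| = |r (4 y + r)|], at most [2 |y|^2] times [5 |y|]. *)
Lemma cosh_taylor2 x : `|x| <= 1 ->
  `|expR x + expR (- x) - 2 - x ^+ 2| <= 2 * `|x| ^+ 3.
Proof.
move=> x1; pose y := x / 2.
have xy : x = y + y by rewrite /y; field.
have y2 : `|y| <= 2^-1 by rewrite /y normrM (@ger0_norm _ 2^-1) // ler_piMl.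
have := expR_sub1x_bound y2.
have := @expR_sub1x_bound (- y); rewrite normrN => /(_ y2).
have := expRxMexpNx_1 y; rewrite xy opprD !expRD.
have := ler_norm y; have := ler_norm (- y); rewrite normrN.
have -> : `|y + y| = 2 * `|y| by rewrite -mulr2n normrMn mulr_natl.
have n2 : `|y| ^+ 2 = y ^+ 2 by rewrite real_normK ?num_real.
move: y2 n2 (normr_ge0 y); set m := `|y|; set a := expR y; set b := expR (- y).
move=> m2 n2 m0 ynm ym ab /andP[b0 b1] /andP[a0 a1].
pose r := a - b - 2 * y.
have rle : `|r| <= 2 * m ^+ 2.
  by rewrite ler_norml n2 /r; apply/andP; split; lra.
have -> : a * a + b * b - 2 - (y + y) ^+ 2 = r * (4 * y + r).
  by rewrite /r; ring: ab.
rewrite normrM.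
have le5 : `|4 * y + r| <= 5 * m.
  apply: le_trans (ler_normD _ _) _; rewrite normrM ger0_norm // -/m; nra.
apply: le_trans (ler_pM _ _ rle le5) _ => //.
have : 0 <= m ^+ 3 by rewrite exprn_ge0.
by rewrite exprMn !exprS expr0 mulr1; lra.
Qed.

End ConvexityCriterion.

(** * Norm bounds from entries *)

Section UnitarilyInvariantNorm.
Variables (R : realType) (n : nat) (N : 'M[R[i]]_n -> R).
Hypotheses (hN : is_mxnorm N) (hinv : unitarily_invariant N).
Implicit Types (Y Z M : 'M[R[i]]_n) (c e : R).

Lemma natc2 : (2 : R)%:C = 2 :> R[i].
Proof. by rewrite rmorph_nat. Qed.

Lemma Re_normc_real c : complex.Re `|c%:C| = `|c|.
Proof. by rewrite normc_def /= expr0n /= addr0 sqrtr_sqr. Qed.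

Lemma mxnormZr c Y : N (c%:C *: Y) = `|c| * N Y.
Proof. by rewrite (mxnormZ hN) Re_normc_real. Qed.

Lemma mxnormN Y : N (- Y) = N Y.
Proof. by rewrite -scaleN1r (mxnormZ hN) normrN1 mul1r. Qed.

Lemma mxnorm0 : N 0 = 0.
Proof. by rewrite -(scale0r 0) (mxnormZ hN) normr0 mul0r. Qed.

Lemma mxnorm_sum (I : finType) (F : I -> 'M[R[i]]_n) :
  N (\sum_i F i) <= \sum_i N (F i).
Proof.
elim/big_rec2: _ => [|i y1 y2 _ h]; first by rewrite mxnorm0.
by apply: le_trans (ler_mxnormD hN _ _) _; rewrite lerD2l.
Qed.

Lemma mxnorm_le_entries M :
  N M <= \sum_i \sum_j complex.Re `|M i j| * N (delta_mx i j).
Proof.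
rewrite {1}[M]matrix_sum_delta; apply: le_trans (mxnorm_sum _) _.
apply: ler_sum => i _; apply: le_trans (mxnorm_sum _) _.
by apply: ler_sum => j _; rewrite (mxnormZ hN).
Qed.

Definition entry_weight Z i j : R := complex.Re `|Z i j| * N (delta_mx i j).

Lemma entry_weight_ge0 Z i j : 0 <= entry_weight Z i j.
Proof.
by rewrite mulr_ge0 ?(mxnorm_ge0 hN) // normc_def sqrtr_ge0.
Qed.

(** Turns scalar estimates into norm estimates, both for continuity and for the cubic remainder. *)
Lemma mxnorm_multiplier (u : 'I_n -> 'I_n -> R) Z :
  N (\matrix_(i, j) ((u i j)%:C * Z i j)) <=
  \sum_i \sum_j `|u i j| * entry_weight Z i j.
Proof.
apply: le_trans (mxnorm_le_entries _) _; apply: ler_sum => i _.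
apply: ler_sum => j _; rewrite mxE normrM /entry_weight mulrA.
by rewrite !normc_def /= !expr0n /= !addr0 !mulr0 subr0 sqrtr_sqr.
Qed.

(** * The operator [lyap] and the norm *)

Variable d : 'I_n -> R.

Let D : 'M[R[i]]_n := diag_mx (\row_i (d i)%:C).

Definition lyap Y : 'M[R[i]]_n := D *m Y + Y *m D.

Lemma lyapE Y i j : lyap Y i j = (d i + d j)%:C * Y i j.
Proof.
rewrite /lyap /D mul_diag_mx mul_mx_diag !mxE.
by rewrite [Y i j * _]mulrC -mulrDl rmorphD.
Qed.

(* The Cayley transform [(1 + i c D) / (1 - i c D)] is unitary. *)
Lemma mxnorm_cayley c Y :
  let V := ('i * c%:C) *: D in
  N ((1%:M + V) *m Y *m (1%:M + V)) = N ((1%:M - V) *m Y *m (1%:M - V)).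
Proof.
move=> V.
pose q i : R[i] := 1 - 'i * c%:C * (d i)%:C.
pose p i : R[i] := 1 + 'i * c%:C * (d i)%:C.
(* Its real part is 1. *)
have q0 i : q i != 0.
  apply/negP => /eqP /(congr1 (@complex.Re _)) /=.
  rewrite !(mulr0, mul0r, mul1r, subr0, oppr0, addr0).
  by move/eqP; rewrite oner_eq0.
have pq i : p i = Num.conj (q i).
  by rewrite /p /q -[RHS]/((_ - _)^*%C); simpc.
pose U : 'M[R[i]]_n := diag_mx (\row_i (p i / q i)).
have UQ : U *m (1%:M - V) = 1%:M + V.
  apply/matrixP => i j; rewrite mul_diag_mx !mxE.
  have [->|ij] := eqVneq i j; last by rewrite !mulr0n mulr0 subr0 addr0 mulr0.
  by rewrite !mulr1n divfK.
have QU : (1%:M - V) *m U = 1%:M + V.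
  apply/matrixP => i j; rewrite mul_mx_diag !mxE.
  have [->|ij] := eqVneq i j; last by rewrite !mulr0n mulr0 subr0 addr0 mul0r.
  by rewrite !mulr1n mulrC divfK.
have Uu : U \is unitarymx.
  apply/unitarymxP/matrixP => i j; rewrite mul_diag_mx !mxE.
  have [->|ij] := eqVneq i j; last by rewrite mulr0n conjC0 mulr0.
  rewrite mulr1n rmorphM fmorphV /= pq /= conjCK mulrACA -invfM [q j * _]mulrC.
  by rewrite mulfV // mulf_neq0 // conjC_eq0.
(* [U] is placed on the outer sides, where invariance removes it. *)
rewrite -{1}UQ -{1}QU !mulmxA.
by rewrite -(hinv ((1%:M - V) *m Y *m (1%:M - V)) Uu Uu) !mulmxA.
Qed.

(** Up to [c^2 D Y D], the two sides of [mxnorm_cayley] are [Y + W] and [Y - W], whose mean is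
    [Y]. *)
Lemma mxnorm_lyap_quad c Y :
  N Y <= N (Y + ('i * c%:C) *: lyap Y) + c ^+ 2 * N (D *m Y *m D).
Proof.
set W := _ *: lyap Y; set C := D *m Y *m D.
have := mxnorm_cayley c Y => /=; set V := _ *: D.
have VYV : V *m Y *m V = - ((c ^+ 2)%:C *: C).
  rewrite /V -!scalemxAl -scalemxAr scalerA -scaleNr; congr (_ *: _).
  by simpc; rewrite expr2.
have WE : W = V *m Y + Y *m V.
  by rewrite /W /lyap scalerDr scalemxAl scalemxAr.
have -> : (1%:M + V) *m Y *m (1%:M + V) = Y + W - (c ^+ 2)%:C *: C.
  by rewrite -VYV WE !(mulmxDl, mulmxDr, mul1mx, mulmx1) !addrA.
have -> : (1%:M - V) *m Y *m (1%:M - V) = Y - W - (c ^+ 2)%:C *: C.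
  rewrite -VYV WE !(mulmxDl, mulmxDr, mul1mx, mulmx1, mulNmx, mulmxN).
  by rewrite opprD opprK !addrA.
set E := (c ^+ 2)%:C *: C => NE.
have NEE : N E = c ^+ 2 * N C by rewrite mxnormZr ger0_norm ?sqr_ge0.
have h1 : N (Y + W - E) <= N (Y + W) + N E.
  by rewrite -(mxnormN E); exact: ler_mxnormD.
have h2 : N (Y - W) <= N (Y - W - E) + N E.
  by rewrite -{1}(subrK E (Y - W)); exact: ler_mxnormD.
have h3 : 2 * N Y <= N (Y + W) + N (Y - W).
  have -> : 2 * N Y = N ((Y + W) + (Y - W)).
    have -> : (Y + W) + (Y - W) = (2 : R)%:C *: Y.
      by rewrite addrACA subrr addr0 -mulr2n -scaler_nat natc2.
    by rewrite mxnormZr ger0_norm.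
  exact: ler_mxnormD.
clear VYV WE; clearbody E C W => {V}.
move: NE NEE h1 h2 h3; move: (c ^+ 2 * N C) => K.
move: (N Y) (N (Y + W)) (N (Y - W)) (N (Y - W - E)) (N (Y + W - E)) (N E).
by clear=> x1 x2 x3 x4 x5 x6; lra.
Qed.

Lemma mxnorm_segment Y Z s : 0 <= s <= 1 ->
  N (Y + s%:C *: Z) <= (1 - s) * N Y + s * N (Y + Z).
Proof.
move=> /andP[s0 s1].
have -> : Y + s%:C *: Z = (1 - s)%:C *: Y + s%:C *: (Y + Z).
  by rewrite scalerDr addrA -scalerDl -rmorphD /= subrK scale1r.
apply: le_trans (ler_mxnormD hN _ _) _.
by rewrite !mxnormZr !ger0_norm // subr_ge0.
Qed.

(** With [s c] for [c], the error in [mxnorm_lyap_quad] is [s^2 K], while convexity of [N] on the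
    segment makes the gain linear in [s]; dividing by [s] leaves [s K <= e]. *)
Lemma mxnorm_lyap c Y : N Y <= N (Y + ('i * c%:C) *: lyap Y).
Proof.
set W := _ *: _; apply/ler_addgt0Pr => e e0.
pose K := c ^+ 2 * N (D *m Y *m D).
have K0 : 0 <= K by rewrite mulr_ge0 ?sqr_ge0 ?(mxnorm_ge0 hN).
pose s := Num.min 1 (e / (K + 1)).
have s0 : 0 < s by rewrite lt_min ltr01 divr_gt0 // ltr_wpDl.
have s1 : s <= 1 by rewrite ge_min lexx.
have sK : s * (K + 1) <= e.
  by rewrite -ler_pdivlMr ?ltr_wpDl // ge_min lexx orbT.
have := mxnorm_lyap_quad (s * c) Y.
have -> : ('i * (s * c)%:C) *: lyap Y = s%:C *: W.
  by rewrite /W scalerA; congr (_ *: _); rewrite rmorphM mulrCA.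
have := @mxnorm_segment Y W s; rewrite ltW // s1 => /(_ isT) h1 h2.
have : s * N Y <= s * (N (Y + W) + e).
  have sKe : s ^+ 2 * K <= s * e.
    rewrite expr2 -mulrA ler_pM2l //; apply: le_trans sK.
    by rewrite ler_pM2l // lerDl.
  rewrite exprMn -mulrA -/K in h2; clearbody W K; move: h1 h2 sKe.
  by move: (N _) (N _) (N _) => x1 x2 x3; lra.
by rewrite ler_pM2l.
Qed.

Lemma lyap_is_linear : linear lyap.
Proof.
move=> a Y Z; rewrite /lyap mulmxDr mulmxDl -scalemxAl -scalemxAr scalerDr.
by rewrite addrACA.
Qed.

(** This is [(1 - a L) (1 + a L) = 1 - a^2 L^2]. *)
Lemma lyap_factor (a : R[i]) Y :
  Y + a *: lyap Y + (- a) *: lyap (Y + a *: lyap Y) =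
  Y + (- (a * a)) *: lyap (lyap Y).
Proof.
have -> : lyap (Y + a *: lyap Y) = a *: lyap (lyap Y) + lyap Y.
  by rewrite addrC lyap_is_linear.
move: (lyap (lyap Y)) (lyap Y) => L2 L1.
rewrite scalerDr scalerA mulNr (scaleNr a) -addrA; congr (_ + _).
by rewrite addrCA subrr addr0.
Qed.

Lemma mxnorm_lyap2 c Y : 0 <= c -> N Y <= N (Y + c%:C *: lyap (lyap Y)).
Proof.
move=> c0; pose a : R[i] := 'i * (Num.sqrt c)%:C.
have aN : 'i * (- Num.sqrt c)%:C = - a by rewrite /a rmorphN mulrN.
have aa : c%:C = - (a * a).
  by rewrite /a; simpc; rewrite -expr2 sqr_sqrtr.
rewrite aa -lyap_factor -aN.
by apply: le_trans (mxnorm_lyap (Num.sqrt c) Y) _; exact: mxnorm_lyap.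
Qed.

End UnitarilyInvariantNorm.

(** * Convexity along the exponential family *)

Section ExponentialFamily.
Variables (R : realType) (n : nat) (N : 'M[R[i]]_n -> R).
Hypotheses (hN : is_mxnorm N) (hinv : unitarily_invariant N).
Variables (d : 'I_n -> R) (Z : 'M[R[i]]_n).

Lemma mxnorm_multiplier_continuous (u : 'I_n -> 'I_n -> R -> R) :
  (forall i j, continuous (u i j)) ->
  continuous (fun t : R => N (\matrix_(i, j) ((u i j t)%:C * Z i j))).
Proof.
move=> uc t; set M := fun t : R => \matrix_(i, j) ((u i j t)%:C * Z i j).
(* Dominates [|N (M t) - N (M s)|] by the reverse triangle inequality. *)
pose g s := \sum_i \sum_j `|u i j t - u i j s| * entry_weight N Z i j.
have gt0 : g t = 0.
  rewrite /g big1 // => i _; rewrite big1 // => j _.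
  by rewrite subrr normr0 mul0r.
have gc : g s @[s --> t] --> (0 : R).
  rewrite -gt0; apply: cvg_big => [|i _]; [exact: add_continuous|].
  apply: cvg_big => [|j _]; [exact: add_continuous|].
  by apply: cvgMl; apply: cvg_norm; apply: cvgB; [exact: cvg_cst|exact: uc].
have Mg s : `|N (M t) - N (M s)| <= g s.
  have dist a b : N (M a) - N (M b) <= N (M a - M b).
    by rewrite lerBlDr -{1}(subrK (M b) (M a)); exact: ler_mxnormD.
  apply: (@le_trans _ _ (N (M t - M s))).
    rewrite ler_norml dist andbT lerNl opprB; apply: le_trans (dist _ _) _.
    by rewrite -opprB mxnormN.
  have -> : M t - M s = \matrix_(i, j) ((u i j t - u i j s)%:C * Z i j).
    by apply/matrixP => i j; rewrite !mxE rmorphB mulrBl.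
  exact: mxnorm_multiplier.
apply/cvgrPdist_le => e e0.
move/cvgrPdist_le : gc => /(_ _ e0); apply: filterS => s.
rewrite sub0r normrN => gse; apply: le_trans (Mg s) _.
exact: le_trans (ler_norm _) gse.
Qed.

Let u i j := d i + d j.

(** This is [e^(tD) Z e^(tD)], written entrywise to avoid matrix exponentials. *)
Definition expfam (t : R) : 'M[R[i]]_n :=
  \matrix_(i, j) ((expR (t * u i j))%:C * Z i j).

Lemma mxnorm_expfam_continuous : continuous (fun t => N (expfam t)).
Proof.
apply: mxnorm_multiplier_continuous => i j t.
apply: continuous_comp; last exact: continuous_expR.
by apply: cvgMl.
Qed.

(** The subtracted matrix is the Taylor remainder; the rest has the shape of [mxnorm_lyap2] with
    [c = h^2 / 2]. *)
Lemma expfam_second_diff t h :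
  expfam (t + h) + expfam (t - h) - \matrix_(i, j)
    ((expR (t * u i j) * (expR (h * u i j) + expR (- (h * u i j)) - 2
                          - (h * u i j) ^+ 2))%:C * Z i j) =
  (2 : R)%:C *: (expfam t + (h ^+ 2 / 2)%:C *: lyap d (lyap d (expfam t))).
Proof.
apply/matrixP => i j.
have : lyap d (lyap d (expfam t)) i j =
    (u i j)%:C * ((u i j)%:C * expfam t i j) by rewrite !lyapE.
move: (lyap d (lyap d _)) => L LE; rewrite !mxE {}LE !mxE.
have -> : (t + h) * u i j = t * u i j + h * u i j by rewrite mulrDl.
have -> : (t - h) * u i j = t * u i j + - (h * u i j) by rewrite mulrBl.
rewrite !expRD exprMn; have -> : h ^+ 2 = 2 * (h ^+ 2 / 2) by field.
move: (expR _) (expR _) (expR _) (h ^+ 2 / 2) => a b b' k.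
have -> : 2 * k / 2 = k by field.
ring.
Qed.

Lemma mxnorm_expfam_second_diff : second_diff_ge0 (fun t => N (expfam t)).
Proof.
move=> t.
exists (\sum_i \sum_j expR (t * u i j) * (2 * `|u i j| ^+ 3) *
        entry_weight N Z i j).
(* [|h| <= 1 / (S + 1)] puts every [h * u i j] in the range of [cosh_taylor2]. *)
pose S := \sum_i \sum_j `|u i j|.
have S0 : 0 <= S by apply: sumr_ge0 => i _; apply: sumr_ge0.
have uS i j : `|u i j| <= S.
  rewrite /S (bigD1 i) //= (bigD1 j) //= -addrA lerDl addr_ge0 //.
    exact: sumr_ge0.
  by apply: sumr_ge0 => k _; exact: sumr_ge0.
have S1 : 0 < S + 1 by rewrite ltr_wpDl.
exists (S + 1)^-1; first by rewrite invr_gt0.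
move=> h hS.
have hu i j : `|h * u i j| <= 1.
  rewrite normrM -(mulVf (lt0r_neq0 S1)) ler_pM //.
  by apply: le_trans (uS i j) _; rewrite lerDl.
have := expfam_second_diff t h.
set E := \matrix_(i, j) _ => Eeq.
have NE : N E <= (\sum_i \sum_j expR (t * u i j) * (2 * `|u i j| ^+ 3) *
                   entry_weight N Z i j) * `|h| ^+ 3.
  apply: le_trans (mxnorm_multiplier hN _ _) _.
  rewrite mulr_suml; apply: ler_sum => i _.
  rewrite mulr_suml; apply: ler_sum => j _.
  rewrite [leRHS]mulrAC ler_wpM2r ?entry_weight_ge0 // normrM.
  rewrite (ger0_norm (expR_ge0 _)) -!mulrA ler_wpM2l ?expR_ge0 //.
  apply: le_trans (cosh_taylor2 (hu i j)) _.
  by rewrite normrM exprMn; lra.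
have h2 : 0 <= h ^+ 2 / 2 by rewrite divr_ge0 ?sqr_ge0.
have le1 : 2 * N (expfam t) <= N (expfam (t + h) + expfam (t - h) - E).
  by rewrite Eeq mxnormZr // ger0_norm // ler_pM2l //; exact: mxnorm_lyap2.
apply: le_trans le1 _; apply: le_trans (ler_mxnormD hN _ _) _.
by rewrite mxnormN // lerD //; exact: ler_mxnormD.
Qed.

Lemma mxnorm_expfam_chord (a b s : R) : 0 <= s <= 1 ->
  N (expfam (s * a + (1 - s) * b)) <=
  s * N (expfam a) + (1 - s) * N (expfam b).
Proof.
exact: below_chord mxnorm_expfam_continuous mxnorm_expfam_second_diff a b s.
Qed.

End ExponentialFamily.

(** * Powers of a positive definite matrix *)

Lemma mulmx_ctr (R : realType) (m n p : nat) (B : 'M[R[i]]_(m, n))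
    (C : 'M[R[i]]_(n, p)) : (B *m C)^t* = C^t* *m B^t*.
Proof. by rewrite trmx_mul map_mxM. Qed.

Section PositiveDefinitePowers.
Variables (R : realType) (n : nat) (A : 'M[R[i]]_n).
Hypothesis hA : posdefmx A.
Implicit Types (X Y B : 'M[R[i]]_n) (t : R).

Local Notation P := (spectralmx A).

Lemma spectral_diag_gt0 i : 0 < complex.Re (spectral_diag A 0 i).
Proof.
have [Aherm Apos] := hA.
have Pu := spectral_unitarymx A.
have PP : P *m P^t* = 1%:M by apply/unitarymxP.
have /orthomx_spectralP AE := hermitian_normalmx Aherm.
rewrite (invmx_unitary Pu) in AE.
(* An eigenvector: the quadratic form of [A] at [x] is the [i]-th eigenvalue. *)
pose x : 'cV[R[i]]_n := P^t* *m delta_mx i 0.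
have Px : P *m x = delta_mx i 0 by rewrite mulmxA PP mul1mx.
have x0 : x != 0.
  apply/eqP => x0; move: Px; rewrite x0 mulmx0 => /matrixP /(_ i 0) /eqP.
  by rewrite !mxE !eqxx /= eq_sym oner_eq0.
have := Apos _ x0; clearbody x.
have -> : x^t* *m A *m x =
    x^t* *m (P^t* *m diag_mx (spectral_diag A) *m P) *m x.
  by rewrite -AE.
have -> : x^t* *m (P^t* *m diag_mx (spectral_diag A) *m P) *m x =
    (P *m x)^t* *m diag_mx (spectral_diag A) *m (P *m x).
  by rewrite mulmx_ctr !mulmxA.
rewrite Px.
rewrite -colE mxE mul_mx_diag !mxE !eqxx conjC1 mul1r.
by rewrite ltcE /= => /andP[].
Qed.

Lemma mxpow_ctr t : (mxpow A t)^t* = mxpow A t.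
Proof.
rewrite /mxpow /mxfun invmx_unitary ?spectral_unitarymx //.
rewrite !mulmx_ctr trmxCK mulmxA; congr (_ *m _ *m _).
rewrite tr_diag_mx map_diag_mx; congr diag_mx.
by apply/matrixP => i j; rewrite !mxE; exact: conjc_real.
Qed.

Lemma mxRe_mxpow (c : R[i]) X t :
  mxRe (c *: (mxpow A t *m X *m mxpow A t)) =
  mxpow A t *m mxRe (c *: X) *m mxpow A t.
Proof.
have := mxpow_ctr t; move: (mxpow A t) => B BE.
rewrite /mxRe scalemxAl scalemxAr; move: (c *: X) => Y.
rewrite -[in RHS]scalemxAr -scalemxAl; congr (_ *: _).
by rewrite !mulmx_ctr BE mulmxDr mulmxDl !mulmxA.
Qed.

(** In the eigenbasis the powers are diagonal, and invariance drops the outer unitary factors. *)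
Lemma mxnorm_mxpow (N : 'M[R[i]]_n -> R) X t : unitarily_invariant N ->
  N (mxpow A t *m X *m mxpow A t) =
  N (expfam (fun i => ln (complex.Re (spectral_diag A 0 i)))
       (P *m X *m P^t*) t).
Proof.
move=> hinv; have Pu := spectral_unitarymx A.
have Pcu : P^t* \is unitarymx by rewrite trmxC_unitary.
rewrite /mxpow /mxfun (invmx_unitary Pu).
set E := diag_mx _; set Y := P *m X *m P^t*.
have -> : P^t* *m E *m P *m X *m (P^t* *m E *m P) = P^t* *m (E *m Y *m E) *m P.
  by rewrite /Y; move: E (P^t*) => E Q; rewrite !mulmxA.
rewrite hinv //; congr N; apply/matrixP => i j.
(* Positive eigenvalues exclude the branch of [powR] at 0, leaving [expR (t * ln x)]. *)
rewrite /E mul_diag_mx mul_mx_diag !mxE /powR !gt_eqF ?spectral_diag_gt0 //.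
by rewrite mulrDr expRD rmorphM /= mulrAC.
Qed.

End PositiveDefinitePowers.

(** * The generalized numerical radius *)

Lemma gen_numradius_has_ubound (R : realType) (n : nat) (N : 'M[R[i]]_n -> R)
    (Y : 'M[R[i]]_n) : is_mxnorm N ->
  has_ubound [set N (mxRe (expi theta *: Y)) | theta in [set: R]].
Proof.
(* Uniform in [theta] since [expi theta] has modulus 1. *)
move=> hN; exists (complex.Re `|(2^-1 : R[i])| * (N Y + N (Y^t*))).
move=> _ [theta _ <-].
have expi1 : complex.Re `|expi theta| = 1.
  by rewrite normc_def /= cos2Dsin2 sqrtr1.
rewrite /mxRe (mxnormZ hN) ler_wpM2l //; first by rewrite normc_def sqrtr_ge0.
apply: le_trans (ler_mxnormD hN _ _) _.
have -> : (expi theta *: Y)^t* = Num.conj (expi theta) *: Y^t*.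
  by apply/matrixP => i j; rewrite !mxE rmorphM.
by rewrite !(mxnormZ hN) norm_conjC expi1 !mul1r.
Qed.

Theorem mainTheorem3 (R : realType) (n : nat) (N : 'M[R[i]]_n -> R)
    (A X : 'M[R[i]]_n)
    (hN : is_mxnorm N) (hinv : unitarily_invariant N) (hA : posdefmx A) :
  convex_function (E := R^o) [set: convex_lmodType R^o]
    (fun t : R => gen_numradius N (mxpow A t *m X *m mxpow A t)).
Proof.
move=> s a b _ _ /=.
have -> : conv s a b = s%:num * (a : R) + (1 - s%:num) * (b : R) by [].
rewrite convRE /unstable.onem.
have s01 : 0 <= s%:num <= 1 by apply/andP; split.
move: s%:num s01 => {}s s01; have /andP[s0 s1] := s01.
apply: ge_sup; first by exists (N (mxRe (expi 0 *:
  (mxpow A (s * a + (1 - s) * b) *m X *m mxpow A (s * a + (1 - s) * b))))), 0.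
move=> _ [theta _ <-].
set d := fun i => ln (complex.Re (spectral_diag A 0 i)).
(* [Z] depends on [theta] but not on [t], so for each [theta] a single exponential family is
   followed. *)
set Z := spectralmx A *m mxRe (expi theta *: X) *m (spectralmx A)^t*.
have fE t : N (mxRe (expi theta *: (mxpow A t *m X *m mxpow A t))) =
    N (expfam d Z t).
  by rewrite mxRe_mxpow // mxnorm_mxpow.
have f_le t : N (expfam d Z t) <= gen_numradius N (mxpow A t *m X *m mxpow A t).
  rewrite -(fE t); apply: ub_le_sup; first exact: gen_numradius_has_ubound.
  by exists theta.
rewrite fE; apply: le_trans (mxnorm_expfam_chord hN hinv _ _ _ _ s01) _.
by apply: lerD; apply: ler_wpM2l; rewrite ?subr_ge0 //; exact: f_le.
Qed.
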